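(* Let $q\geq 0$ be any integer and let $U\subset\mathbb{C}^n$ be a non-empty open set. Every function $u\in\mathit{PSH}_q(U)$ is $q$-plurisubharmonic in the viscosity sense on $U$.
   Context: Definitions. Let $U\subset\mathbb{C}^n$ be open and $u:U\to[-\infty,\infty)$ upper semi-continuous. (i) $u$ is subpluriharmonic on $U$ if either $u\equiv-\infty$ on $U$, or for every compact ball $\overline{B}\subset U$ and every continuous plurisubharmonic function $h$ defined in a neighborhood of $\overline{B}$, the restriction of $u+h$ to $\overline{B}$ attains its maximum on the boundary $bB$. (ii) For an integer $0\leq q<n$, $u$ is $q$-plurisubharmonic on $U$ if it is subpluriharmonic on $U\cap\pi$ for every $(q+1)$-dimensional complex affine subspace $\pi$ of $\mathbb{C}^n$ (where $\pi$ is identified with $\mathbb{C}^{q+1}$). For integers $q\geq n$, by convention every upper semi-continuous function is $q$-plurisubharmonic. $\mathit{PSH}_q(U)$ denotes the set of all $q$-plurisubharmonic functions on $U$. (iii) For a real-valued $\mathcal{C}^2$ function $\varphi$, its complex Hessian is the Hermitian matrix $H^{\mathbb{C}}\varphi=\left[\frac{\partial^2\varphi}{\partial z_k\partial\overline{z_\ell}}\right]_{k,\ell=1,\ldots,n}$. For a Hermitian matrix $\mathcal{A}$, $\ominus(\mathcal{A})$ denotes the number of strictly negative eigenvalues of $\mathcal{A}$ (counted with multiplicity). (iv) For an integer $q\geq 0$, $u$ is $q$-plurisubharmonic in the viscosity sense on $U$ if either $u\equiv-\infty$ on $U$, or for every real-valued $\varphi\in\mathcal{C}^2(U)$ one has $\ominus(H^{\mathbb{C}}\varphi(\hat{p}))\leq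 q$ at every point $\hat{p}\in U$ where $u-\varphi$ attains its maximum over $U$. *)

(* Defs.v *)
From HB Require Import structures.
From mathcomp Require Import all_boot all_order all_algebra.
From mathcomp Require Import all_classical all_reals all_analysis.
From mathcomp Require Import complex.

Set Implicit Arguments.
Unset Strict Implicit.
Unset Printing Implicit Defensive.

Import Order.TTheory GRing.Theory Num.Theory.
Import numFieldNormedType.Exports.

Local Open Scope classical_set_scope.
Local Open Scope ring_scope.
Local Open Scope complex_scope.

(* MathComp-Analysis equips abstract numFieldTypes with the topology of their
   norm, but [complex R] only through its regular algebra. With these copies
   ['rV[R[i]]_n], playing the role of C^n, carries the product topology. *)
HB.instance Definition _ (R : realType) := GRing.ComAlgebra.copy R[i] R[i]^o.
HB.instance Definition _ (R : realType) := Vector.copy R[i] R[i]^o.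
HB.instance Definition _ (R : realType) := NormedModule.copy R[i] R[i]^o.

(* The library norm on ['rV_n] is the sup norm; balls of C^n are Euclidean. *)
Definition enorm (R : realType) (n : nat) (z : 'rV[R[i]]_n) : R :=
  Num.sqrt (\sum_(k < n) (complex.Re (z 0 k) ^+ 2 + complex.Im (z 0 k) ^+ 2)).

Definition cball (R : realType) (n : nat) (c : 'rV[R[i]]_n) (r : R) :
  set 'rV[R[i]]_n := [set z | enorm (z - c) <= r].

Definition sphere (R : realType) (n : nat) (c : 'rV[R[i]]_n) (r : R) :
  set 'rV[R[i]]_n := [set z | enorm (z - c) = r].

(* Upper semi-continuous functions U -> [-oo, +oo[. In all the definitions
   below U is meant to be open and values outside U are irrelevant. *)
Definition usc (R : realType) (T : topologicalType) (U : set T)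
    (u : T -> \bar R) : Prop :=
  forall x, U x -> (u x < +oo)%E /\
    forall a : R, (u x < a%:E)%E ->
      \forall y \near within U (nbhs x), (u y < a%:E)%E.

(* Sub-mean value property on every closed disc of every complex line. *)
Definition plurisubharmonic (R : realType) (n : nat) (V : set 'rV[R[i]]_n)
    (v : 'rV[R[i]]_n -> \bar R) : Prop :=
  usc V v /\
  forall a b : 'rV[R[i]]_n,
    (forall zeta : R[i], `|zeta| <= 1 -> V (a + zeta *: b)) ->
    (v a <= ((2 * pi)^-1)%R%:E *
      \int[@lebesgue_measure R]_(t in `[0%R, (2 * pi)%R]%classic)
        v (a + (cos t +i* sin t) *: b)%R)%E.

Definition subpluriharmonic (R : realType) (n : nat) (U : set 'rV[R[i]]_n)
    (u : 'rV[R[i]]_n -> \bar R) : Prop :=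
  usc U u /\
  ((forall z, U z -> u z = -oo%E) \/
   forall (c : 'rV[R[i]]_n) (r : R) (V : set 'rV[R[i]]_n)
          (h : 'rV[R[i]]_n -> R),
     0 < r -> cball c r `<=` U ->
     open V -> cball c r `<=` V ->
     (forall z, V z -> {for z, continuous h}) ->
     plurisubharmonic V (EFin \o h) ->
     exists2 w, sphere c r w &
       forall z, cball c r z -> (u z + (h z)%:E <= u w + (h w)%:E)%E).

(* A (q+1)-dimensional complex affine subspace is [a + z *m B] with z in
   C^(q+1), where the rows of B form an orthonormal basis of its direction
   ([unitarymx] is [B *m B^t* = 1] for rectangular B). This identification with
   C^(q+1) is isometric, so that the balls of C^(q+1) are those of the subspace;
   two choices of (a, B) differ by a rigid motion of C^(q+1). *)
Definition PSHq (R : realType) (n q : nat) (U : set 'rV[R[i]]_n) :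
  set ('rV[R[i]]_n -> \bar R) :=
  [set u | usc U u /\
    ((q < n)%N ->
     forall (a : 'rV[R[i]]_n) (B : 'M[R[i]]_(q.+1, n)), B \is unitarymx ->
       @subpluriharmonic R q.+1 [set z | U (a + z *m B)]
                        (fun z => u (a + z *m B)))].

(* Derivative at z along v of f, as a function of 2n real variables. *)
Definition rderive (R : realType) (n : nat) (v : 'rV[R[i]]_n)
    (f : 'rV[R[i]]_n -> R) (z : 'rV[R[i]]_n) : R :=
  derive1 (fun t : R => f (z + t%:C *: v)) 0.

Definition rderivable (R : realType) (n : nat) (v : 'rV[R[i]]_n)
    (f : 'rV[R[i]]_n -> R) (z : 'rV[R[i]]_n) : Prop :=
  derivable (fun t : R => f (z + t%:C *: v)) 0 1.

Definition dirx (R : realType) (n : nat) (k : 'I_n) : 'rV[R[i]]_n :=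
  delta_mx 0 k.

Definition diry (R : realType) (n : nat) (k : 'I_n) : 'rV[R[i]]_n :=
  'i *: delta_mx 0 k.

(* The real coordinate directions: true for x_k, false for y_k. *)
Definition rdir (R : realType) (n : nat) (d : bool * 'I_n) : 'rV[R[i]]_n :=
  if d.1 then dirx R d.2 else diry R d.2.

Definition C1_on (R : realType) (n : nat) (U : set 'rV[R[i]]_n)
    (f : 'rV[R[i]]_n -> R) : Prop :=
  (forall z, U z -> {for z, continuous f}) /\
  forall d : bool * 'I_n, forall z, U z ->
    rderivable (rdir R d) f z /\ {for z, continuous (rderive (rdir R d) f)}.

Definition C2_on (R : realType) (n : nat) (U : set 'rV[R[i]]_n)
    (f : 'rV[R[i]]_n -> R) : Prop :=
  C1_on U f /\ forall d : bool * 'I_n, C1_on U (rderive (rdir R d) f).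

Definition cderive (R : realType) (n : nat) (v : 'rV[R[i]]_n)
    (f : 'rV[R[i]]_n -> R[i]) (z : 'rV[R[i]]_n) : R[i] :=
  rderive v (fun w => complex.Re (f w)) z
    +i* rderive v (fun w => complex.Im (f w)) z.

(* Wirtinger operators d/dz_k and d/dconj(z_l). *)
Definition dz (R : realType) (n : nat) (k : 'I_n)
    (f : 'rV[R[i]]_n -> R[i]) (z : 'rV[R[i]]_n) : R[i] :=
  2^-1 * (cderive (dirx R k) f z - 'i * cderive (diry R k) f z).

Definition dzbar (R : realType) (n : nat) (l : 'I_n)
    (f : 'rV[R[i]]_n -> R[i]) (z : 'rV[R[i]]_n) : R[i] :=
  2^-1 * (cderive (dirx R l) f z + 'i * cderive (diry R l) f z).

Definition complex_hessian (R : realType) (n : nat) (phi : 'rV[R[i]]_n -> R)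
    (z : 'rV[R[i]]_n) : 'M[R[i]]_n :=
  \matrix_(k, l) dz k (dzbar l (fun w => (phi w)%:C)) z.

(* Eigenvalues with multiplicity are the roots of the characteristic polynomial;
   [x < 0] in R[i] means that x is real and negative. *)
Definition neg_eigenvalues (R : realType) (n : nat) (A : 'M[R[i]]_n) : nat :=
  count (fun x : R[i] => x < 0) (sval (closed_field_poly_normal (char_poly A))).

Definition viscosity_PSHq (R : realType) (n q : nat) (U : set 'rV[R[i]]_n)
    (u : 'rV[R[i]]_n -> \bar R) : Prop :=
  usc U u /\
  ((forall z, U z -> u z = -oo%E) \/
   forall phi : 'rV[R[i]]_n -> R, C2_on U phi ->
     forall p, U p ->
       (forall z, U z -> (u z - (phi z)%:E <= u p - (phi p)%:E)%E) ->
       (neg_eigenvalues (complex_hessian phi p) <= q)%N).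

(* Main.v *)
Require Import Defs.
From mathcomp Require Import all_boot all_order all_algebra.
From mathcomp Require Import all_classical all_reals all_analysis.
From mathcomp Require Import complex spectral ring lra.

Set Implicit Arguments.
Unset Strict Implicit.
Unset Printing Implicit Defensive.

Import Order.TTheory GRing.Theory Num.Theory.
Import numFieldNormedType.Exports.

Local Open Scope classical_set_scope.
Local Open Scope ring_scope.
Local Open Scope complex_scope.

(** Let phi be of class C^2, let u - phi have a maximum over U at p, and suppose that
    the complex Hessian of phi at p has at least q + 1 negative eigenvalues. By the
    spectral theorem there is an isometric embedding z |-> p + z B of C^(q+1) along
    eigenvectors on which the Levi form of phi is at most - c |z|^2 with c > 0
    ([negative_definite_frame]).

    The second order Taylor polynomial of a real function splits as a constant, plus
    the real part of a holomorphic polynomial of degree at most two, plus the Levi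
    form. Indeed let S be the real Hessian form. Then S(w, w) is the half-sum of
    S(w, w) - S(i w, i w), which is twice the real part of a complex quadratic form,
    and of S(w, w) + S(i w, i w), which is four times the Levi form ([levi_form]).
    Let h be minus the pluriharmonic part on the slice. It is continuous and
    plurisubharmonic, its mean over each circle being its value at the centre
    ([pluriharm_quad_psh]). Combined with the Taylor estimate [taylor_upper] this
    gives phi (p + z B) + h z <= phi p - lam |z|^2 for small z, with lam > 0
    ([pluriharmonic_majorant_on_slice]).

    Since u - phi is maximal at p, the function u + h on a small closed ball of the
    slice is at most u p - lam r^2 on the sphere of radius r but equal to u p at the
    centre. This contradicts subpluriharmonicity on the slice, because u p is finite
    unless u is identically -oo.

    The first half of the file is the calculus of functions whose partial derivatives
    along the 2n real coordinate directions are continuous: linearity of the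
    directional derivative in the direction ([rderive_sum]), symmetry of second
    derivatives ([rhess_sym]), which makes the complex Hessian Hermitian, and the
    second order Taylor bound. *)

(** * Real lines and planes in C^n *)

Lemma normcRe (R : realType) (x : R[i]) :
  `|x| = (Num.sqrt (complex.Re x ^+ 2 + complex.Im x ^+ 2))%:C.
Proof. by case: x. Qed.

Lemma real_complex_continuous (R : realType) : continuous (fun t : R => t%:C : R[i]).
Proof.
move=> t; apply/cvgrPdist_lt => e e0.
have [er0 eE] : 0 < complex.Re e /\ e = (complex.Re e)%:C.
  by move: e0; rewrite ltcE /= => /andP[/eqP + ->]; case: (e) => x y /= ->.
near=> s; rewrite eE.
rewrite -rmorphB /= normcRe /= expr0n addr0 sqrtr_sqr ltcR.
by near: s; exact: (@cvgr_dist_lt _ _ _ _ _ id).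
Unshelve. all: by end_near. Qed.

(** Mean value arguments evaluate derivatives at unknown points of a small
    parallelogram spanned by two directions. This turns continuity on C^n into a
    statement about the two real parameters of such points. *)
Lemma near_plane (R : realType) n (z a b : 'rV[R[i]]_n) (A : set 'rV[R[i]]_n) :
  nbhs z A -> exists2 d : R, 0 < d &
    forall s t : R, `|s| <= d -> `|t| <= d -> A (z + s%:C *: a + t%:C *: b).
Proof.
move=> zA.
have cont : (fun x : R * R => z + x.1%:C *: a + x.2%:C *: b) @ (0, 0) --> z.
  rewrite -[X in _ --> X](_ : z + (0 : R)%:C *: a + (0 : R)%:C *: b = _); last first.
    by rewrite !scale0r !addr0.
  apply: cvgD; [apply: cvgD; first exact: cvg_cst|].
  - apply: cvgZr_tmp; exact: (cvg_comp (@fst R R) _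
      (@cvg_fst R R (nbhs 0) (nbhs 0) _) (@real_complex_continuous R 0)).
  - apply: cvgZr_tmp; exact: (cvg_comp (@snd R R) _
      (@cvg_snd R R (nbhs 0) (nbhs 0) _) (@real_complex_continuous R 0)).
have /nbhs_ballP[e /= e0 he] := cont _ zA.
exists (e / 2); first by rewrite divr_gt0.
move=> s t hs ht; apply: (he (s, t)); split => /=; rewrite /ball /= sub0r normrN.
  by apply: le_lt_trans hs _; lra.
by apply: le_lt_trans ht _; lra.
Qed.

(** * Directional derivatives along real vectors *)

(** A directional derivative at a point of a line is the ordinary derivative, at
    the corresponding parameter, of the restriction to that line. *)
Lemma is_derive_line (R : realType) n (f : 'rV[R[i]]_n -> R) v z (t : R) :
  rderivable v f (z + t%:C *: v) ->
  is_derive t 1 (fun s : R => f (z + s%:C *: v)) (rderive v f (z + t%:C *: v)).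
Proof.
move=> df.
have -> : (fun s : R => f (z + s%:C *: v)) =
    (fun s : R => f ((z + t%:C *: v) + s%:C *: v)) \o (fun s => s - t).
  by apply/funext => s /=; rewrite -addrA -scalerDl -rmorphD /= [t + _]addrC subrK.
rewrite -[rderive _ _ _]mulr1; apply: is_derive1_comp; last first.
  by apply: is_derive_eq; rewrite subr0.
rewrite (subrr t); split; [exact: df|by rewrite /rderive derive1E].
Qed.

Lemma is_derive_line0 (R : realType) n (f : 'rV[R[i]]_n -> R) v z :
  rderivable v f z ->
  is_derive (0 : R) 1 (fun s : R => f (z + s%:C *: v)) (rderive v f z).
Proof. by move=> df; split; [exact: df|rewrite /rderive derive1E]. Qed.

Lemma is_derive_rderive (R : realType) n (f : 'rV[R[i]]_n -> R) v z a :
  is_derive (0 : R) 1 (fun s : R => f (z + s%:C *: v)) a ->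
  rderivable v f z /\ rderive v f z = a.
Proof. by move=> h; split; [case: h|rewrite /rderive derive1E derive_val]. Qed.

(** The sign of t is free: increments along a line are needed on both sides of
    the base point. *)
Lemma mean_value (R : realType) (g dg : R -> R) (t : R) :
  (forall s : R, `|s| <= `|t| -> is_derive s 1 g (dg s)) ->
  exists2 s, `|s| <= `|t| & g t - g 0 = t * dg s.
Proof.
move=> dgP; have [t0|t0] := leP 0 t.
- have [s||s] := @MVT_segment R g dg 0 t t0.
  + rewrite in_itv /= => /andP[s0 st]; apply: dgP.
    by rewrite !ger0_norm // ltW.
  + apply: derivable_within_continuous => s; rewrite in_itv /= => /andP[s0 st].
    by apply: (@ex_derive _ _ _ _ _ _ (dg s)); apply: dgP; rewrite !ger0_norm.
  + rewrite in_itv /= => /andP[s0 st] ->; exists s; first by rewrite !ger0_norm.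
    by rewrite subr0 mulrC.
- have [s||s] := @MVT_segment R g dg t 0 (ltW t0).
  + rewrite in_itv /= => /andP[s0 st]; apply: dgP.
    by rewrite !ltr0_norm// lerN2 ltW.
  + apply: derivable_within_continuous => s; rewrite in_itv /= => /andP[s0 st].
    by apply: (@ex_derive _ _ _ _ _ _ (dg s)); apply: dgP; rewrite !ler0_norm ?lerN2 // ltW.
  + rewrite in_itv /= => /andP[s0 st] e; exists s.
      by rewrite !ler0_norm ?lerN2 // ltW.
    by rewrite -opprB e sub0r mulrN opprK mulrC.
Qed.

Lemma mean_value_dir (R : realType) n (f : 'rV[R[i]]_n -> R) v z (t : R) :
  (forall s : R, `|s| <= `|t| -> rderivable v f (z + s%:C *: v)) ->
  exists2 s : R, `|s| <= `|t| &
    f (z + t%:C *: v) - f z = t * rderive v f (z + s%:C *: v).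
Proof.
move=> df.
have [s st e] := @mean_value R (fun s => f (z + s%:C *: v))
  (fun s => rderive v f (z + s%:C *: v)) t (fun s st => is_derive_line (df s st)).
by exists s => //; rewrite -e scale0r addr0.
Qed.

Lemma rderiveZ (R : realType) n (f : 'rV[R[i]]_n -> R) v z (c : R) :
  rderivable v f z ->
  rderivable (c%:C *: v) f z /\ rderive (c%:C *: v) f z = c * rderive v f z.
Proof.
move=> df; apply: is_derive_rderive.
have -> : (fun s : R => f (z + s%:C *: (c%:C *: v))) =
    (fun s : R => f (z + s%:C *: v)) \o (fun s => c * s).
  by apply/funext => s /=; rewrite scalerA -rmorphM /= mulrC.
rewrite mulrC; apply: is_derive1_comp; last first.
  by have := is_deriveZ c (is_derive_id (0 : R) 1); rewrite /GRing.scale/= mulr1.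
by rewrite mulr0; exact: is_derive_line0.
Qed.

Lemma is_derive_slope (R : realType) (g : R -> R) (a : R) :
  t^-1 * (g t - g 0) @[t --> (0 : R)^'] --> a -> is_derive (0 : R) 1 g a.
Proof.
move=> ga.
have e : (fun h => h^-1 *: ((g \o shift 0) (h *: 1) - g 0)) =
    (fun t => t^-1 * (g t - g 0)).
  by apply/funext => h /=; rewrite addr0 /GRing.scale/= mulr1.
by split; [apply/cvg_ex; exists a; rewrite e|apply: cvg_lim => //; rewrite e].
Qed.

(** Split the increment along a + b at z + t a. The piece along a is the definition
    of the derivative; by the mean value theorem the piece along b is t times
    the b-derivative at a point near z, and the continuity of that derivative g
    makes the quotient converge. Existence along b is needed around z, along a
    only at z, which is what lets directions be added one at a time. *)
Lemma rderiveD (R : realType) n (U : set 'rV[R[i]]_n) (f g : 'rV[R[i]]_n -> R)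
    a b z :
  open U -> U z -> rderivable a f z ->
  (forall w, U w -> rderivable b f w /\ rderive b f w = g w) ->
  {for z, continuous g} ->
  rderivable (a + b) f z /\ rderive (a + b) f z = rderive a f z + g z.
Proof.
move=> oU Uz da db cg; apply: is_derive_rderive.
pose k (t : R) := f (z + t%:C *: a + t%:C *: b) - f (z + t%:C *: a).
have -> : (fun s : R => f (z + s%:C *: (a + b))) =
    (fun s : R => f (z + s%:C *: a)) + k.
  by apply/funext => s /=; rewrite /k fctE addrC subrK scalerDr addrA.
apply: is_deriveD; first exact: is_derive_line0.
apply: is_derive_slope; apply/cvgrPdist_le => e e0.
have : nbhs z (U `&` [set w | `|g z - g w| <= e]).
  apply: filterI; first exact: open_nbhs_nbhs.
  by move/cvgrPdist_le : cg; apply.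
move=> /(near_plane a b)[d d0 hd].
near=> t.
have t0 : t != 0 by near: t; exact: nbhs_dnbhs_neq.
have td : `|t| <= d by near: t; exact: dnbhs0_le.
have [s st ks] := @mean_value_dir _ _ f b (z + t%:C *: a) t
  (fun s st => (db _ (hd t s td (le_trans st td)).1).1).
have -> : k 0 = 0.
  by rewrite /k (scale0r a) (scale0r b) (addr0 z) (addr0 z) (subrr (f z)).
have [Us gs] := hd t s td (le_trans st td).
by rewrite subr0 /k ks (db _ Us).2 mulKf.
Unshelve. all: by end_near. Qed.

(** Indexed like [rdir], so that real sums over the 2n coordinate directions
    can be written with a single index. *)
Definition rcoord (R : realType) n (w : 'rV[R[i]]_n) (d : bool * 'I_n) : R :=
  if d.1 then complex.Re (w 0 d.2) else complex.Im (w 0 d.2).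

Lemma big_rdir (V : nmodType) n (F : bool * 'I_n -> V) :
  \sum_d F d = \sum_k (F (true, k) + F (false, k)).
Proof.
rewrite big_split/= -(big_bool _ (fun b => \sum_k F (b, k))) pair_bigA /=.
by apply: eq_bigr => -[].
Qed.

Lemma rcoord_sum (R : realType) n (w : 'rV[R[i]]_n) :
  w = \sum_d (rcoord w d)%:C *: rdir R d.
Proof.
rewrite big_rdir {1}[w]row_sum_delta; apply: eq_bigr => k _.
rewrite /rcoord/rdir/= /dirx/diry scalerA -scalerDl; congr (_ *: _).
rewrite [LHS]complexE /=; congr (_ + _).
by rewrite mulrC.
Qed.

(** The coordinate directions are adjoined one by one with [rderiveD]; its
    asymmetry matches the induction, since only the new direction has to have a
    derivative that is known to be continuous. *)
Lemma rderive_sum (R : realType) n (U : set 'rV[R[i]]_n) (f : 'rV[R[i]]_n -> R) :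
  open U -> C1_on U f -> forall v z, U z ->
  rderivable v f z /\
  rderive v f z = \sum_d rcoord v d * rderive (rdir R d) f z.
Proof.
move=> oU [cf C1f] v; rewrite {1 2}[v]rcoord_sum.
elim: (index_enum _) => [|d s IHs] z Uz.
  rewrite !big_nil; apply: is_derive_rderive.
  under eq_fun do rewrite scaler0 addr0.
  exact: is_derive_cst.
rewrite !big_cons addrC [X in _ = X]addrC.
have dd w : U w -> rderivable ((rcoord v d)%:C *: rdir R d) f w /\
    rderive ((rcoord v d)%:C *: rdir R d) f w = rcoord v d * rderive (rdir R d) f w.
  by move=> Uw; apply: rderiveZ; have [] := C1f d w Uw.
have [ds <-] := IHs z Uz.
apply: (rderiveD oU Uz ds dd).
have [_ cd] := C1f d z Uz.
by apply: continuousM; [exact: cst_continuous|exact: cd].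
Qed.

(** * Euclidean norm and real coordinates *)

Lemma enorm_sum (R : realType) n (w : 'rV[R[i]]_n) :
  enorm w ^+ 2 = \sum_d rcoord w d ^+ 2.
Proof.
rewrite /enorm sqr_sqrtr ?big_rdir//.
by apply: sumr_ge0 => k _; rewrite addr_ge0 ?sqr_ge0.
Qed.

Lemma enorm_ge0 (R : realType) n (w : 'rV[R[i]]_n) : 0 <= enorm w.
Proof. exact: sqrtr_ge0. Qed.

Lemma rcoord_le (R : realType) n (w : 'rV[R[i]]_n) d : `|rcoord w d| <= enorm w.
Proof.
rewrite -(ler_pXn2r (n := 2)) ?nnegrE ?enorm_ge0// enorm_sum real_normK ?num_real//.
rewrite (bigD1 d)//= lerDl.
by apply: sumr_ge0 => k _; rewrite sqr_ge0.
Qed.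

Lemma rcoordZ (R : realType) n (w : 'rV[R[i]]_n) (c : R) d :
  rcoord (c%:C *: w) d = c * rcoord w d.
Proof.
by rewrite /rcoord !mxE; case: (w 0 d.2) => a b /=; rewrite !mul0r subr0 addr0 ; case: ifP.
Qed.

Lemma enormZ (R : realType) n (w : 'rV[R[i]]_n) (c : R) :
  enorm (c%:C *: w) = `|c| * enorm w.
Proof.
apply/eqP; rewrite -(eqrXn2 (n := 2)) ?enorm_ge0 ?mulr_ge0 ?enorm_ge0//.
rewrite exprMn !enorm_sum real_normK ?num_real// mulr_sumr.
by apply/eqP/eq_bigr => d _; rewrite rcoordZ exprMn.
Qed.

(** The topology of C^n is that of the sup norm, while balls are Euclidean: this is
    the comparison used to pass from one to the other. *)
Lemma near_enorm (R : realType) n (z : 'rV[R[i]]_n) (A : set 'rV[R[i]]_n) :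
  nbhs z A -> exists2 e : R, 0 < e & forall w, enorm w <= e -> A (z + w).
Proof.
move=> /nbhs_ballP[e /= e0 he].
move: (e0); rewrite ltcE /= => /andP[/eqP eI eR].
exists (complex.Re e / 3); first by rewrite divr_gt0.
move=> w we; apply: he; split => // i j; rewrite /ball/= mxE ord1.
rewrite opprD addrA subrr sub0r normrN normcRe ltcE /= eI eqxx /=.
apply: (@le_lt_trans _ _ (enorm w)); last by move: we eR; clear; lra.
rewrite -(ler_pXn2r (n := 2)) ?nnegrE ?enorm_ge0 ?sqrtr_ge0//.
rewrite sqr_sqrtr ?addr_ge0 ?sqr_ge0// enorm_sum big_rdir (bigD1 j)//=.
by rewrite lerDl; apply: sumr_ge0 => k _; rewrite addr_ge0 ?sqr_ge0.
Qed.

Lemma is_derive_line_C1 (R : realType) n (U : set 'rV[R[i]]_n) (f : 'rV[R[i]]_n -> R) z w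
    (t : R) :
  open U -> C1_on U f -> U (z + t%:C *: w) ->
  is_derive t 1 (fun s : R => f (z + s%:C *: w))
    (\sum_d rcoord w d * rderive (rdir R d) f (z + t%:C *: w)).
Proof.
move=> oU C1f Ut; have [df <-] := rderive_sum oU C1f w Ut.
exact: is_derive_line.
Qed.

(** Two applications of the mean value theorem: to g1, giving the bound
    g1 t - g1 0 <= K t, then to g minus the quadratic polynomial whose second
    derivative is K. *)
Lemma taylor_unit (R : realType) (g g1 g2 : R -> R) (K : R) :
  (forall t : R, 0 <= t <= 1 -> is_derive t 1 g (g1 t)) ->
  (forall t : R, 0 <= t <= 1 -> is_derive t 1 g1 (g2 t)) ->
  (forall t : R, 0 <= t <= 1 -> g2 t <= K) ->
  g 1 <= g 0 + g1 0 + K / 2.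
Proof.
move=> dg dg1 g2K.
have mv (h h1 : R -> R) (t : R) : 0 <= t <= 1 -> 
    (forall t : R, 0 <= t <= 1 -> is_derive t 1 h (h1 t)) ->
    exists2 c, 0 <= c <= t & h t - h 0 = h1 c * t.
  move=> /andP[t0 t1] dh.
  have sub (s : R) : 0 <= s <= t -> 0 <= s <= 1.
    by move=> /andP[-> /= /le_trans]; exact.
  have [s||s] := @MVT_segment R h h1 0 t t0.
  - by rewrite in_itv /= => /andP[s0 st]; apply: dh; rewrite sub ?ltW.
  - apply: derivable_within_continuous => s; rewrite in_itv /= => st.
    by apply: (@ex_derive _ _ _ _ _ _ (h1 s)); apply: dh; apply: sub.
  - by rewrite in_itv /= => ? ->; exists s; rewrite ?subr0.
have g1le t : 0 <= t <= 1 -> g1 t - g1 0 <= K * t.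
  move=> t01; have [c /andP[c0 ct] ->] := mv _ _ _ t01 dg1.
  by move: t01 => /andP[t0 t1]; rewrite ler_wpM2r// g2K// c0 (le_trans ct).
have [||c c01] := mv (fun s => g s - (g1 0 * s + K / 2 * s ^+ 2))
  (fun s => g1 s - (g1 0 + K * s)) 1.
- by rewrite ler01 lexx.
- move=> t t01; have ? := dg t t01.
  by apply: is_derive_eq; rewrite /GRing.scale /=; lra.
- have := g1le c c01; lra.
Qed.

(** * Symmetry of second derivatives and Taylor's upper bound *)

Definition rhess (R : realType) n (f : 'rV[R[i]]_n -> R) (z : 'rV[R[i]]_n)
    (d e : bool * 'I_n) : R :=
  rderive (rdir R d) (rderive (rdir R e) f) z.

(** The mean value theorem in the direction a, applied to the difference of f and
    its translate by t b, and then in the direction b, applied to the a-derivative. *)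
Lemma mixed_difference (R : realType) n (f : 'rV[R[i]]_n -> R) z a b (t : R) :
  (forall s r : R, `|s| <= `|t| -> `|r| <= `|t| ->
     let w := z + s%:C *: a + r%:C *: b in
     rderivable a f w /\ rderivable b (rderive a f) w) ->
  exists s r : R, [/\ `|s| <= `|t|, `|r| <= `|t| &
    f (z + t%:C *: a + t%:C *: b) - f (z + t%:C *: a) - (f (z + t%:C *: b) - f z)
    = t * (t * rderive b (rderive a f) (z + s%:C *: a + r%:C *: b))].
Proof.
move=> df.
have [s|s st] := @mean_value R
  (fun s => f (z + t%:C *: b + s%:C *: a) - f (z + s%:C *: a))
  (fun s => rderive a f (z + t%:C *: b + s%:C *: a) - rderive a f (z + s%:C *: a)) t.
  move=> st; apply: is_deriveB.
    by apply: is_derive_line; rewrite addrAC; apply: (df s t st _).1.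
  apply: is_derive_line; have := (df s 0 st _).1; rewrite normr0 normr_ge0 => /(_ isT).
  by rewrite (scale0r b) addr0.
rewrite !(scale0r a) !addr0 !(addrAC z (t%:C *: b)) => ->.
have [r rt ->] := @mean_value_dir R n (rderive a f) b (z + s%:C *: a) t
  (fun r rt => (df s r st rt).2).
by exists s, r.
Qed.

(** Schwarz's theorem: the second difference over the square spanned by t times
    the two directions is symmetric in them, and [mixed_difference] expresses it
    by either mixed derivative at some point of the square. Both are within
    eps / 2 of their values at p. *)
Lemma rhess_sym (R : realType) n (U : set 'rV[R[i]]_n) (f : 'rV[R[i]]_n -> R) p d e :
  open U -> C2_on U f -> U p -> rhess f p d e = rhess f p e d.
Proof.
have swap (x y z w : R) : x - y - (z - w) = x - z - (y - w) by ring.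
have close (eps x y z : R) : `|x - z| <= eps / 2 -> `|y - z| <= eps / 2 ->
    `|x - y| <= eps.
  move=> xz yz; rewrite (splitr eps) (le_trans (ler_distD z _ _))//.
  by rewrite (distrC z) lerD.
move=> oU [[_ C1f] C2f] Up.
apply/eqP; rewrite -subr_eq0 -normr_le0; apply/ler_addgt0Pl => eps eps0.
rewrite addr0.
pose E d' e' : set 'rV[R[i]]_n := [set w |
  `|rhess f p d' e' - rderive (rdir R d') (rderive (rdir R e') f) w| <= eps / 2].
have near_hess d' e' : nbhs p (E d' e').
  have [_ /(_ d' p Up)[_ c]] := C2f e'.
  by move/cvgrPdist_le : c; apply; rewrite divr_gt0.
have : nbhs p (U `&` (E d e `&` E e d)).
  by apply: filterI; [exact: open_nbhs_nbhs|exact: filterI].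
move=> /(near_plane (rdir R d) (rdir R e))[t t0 ht].
have tt : `|t| = t by rewrite gtr0_norm.
have dd d' w : U w -> rderivable (rdir R d') f w by case/(C1f d').
have de d' e' w : U w -> rderivable (rdir R e') (rderive (rdir R d') f) w.
  by move=> Uw; have [_ /(_ e' w Uw)[]] := C2f d'.
have [s r|s1 [r1 [st1 rt1 e1]]] := @mixed_difference R n f p (rdir R d) (rdir R e) t.
  by rewrite tt => st rt; have [Uw _] := ht s r st rt; split; [exact: dd|exact: de].
have [s r|s2 [r2 [st2 rt2 e2]]] := @mixed_difference R n f p (rdir R e) (rdir R d) t.
  rewrite tt => st rt; have [Uw _] := ht r s rt st.
  by rewrite addrAC; split; [exact: dd|exact: de].
have cancel_t2 (x y X Y : R) : X = t * (t * x) -> Y = t * (t * y) -> X = Y -> x = y.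
  by have tn0 : t != 0 by [rewrite gt_eqF]; move=> -> -> /(mulfI tn0)/(mulfI tn0).
rewrite (addrAC p (t%:C *: rdir R e)) swap in e2.
have {e1 e2} e12 := cancel_t2 _ _ _ _ e1 e2 erefl.
rewrite (addrAC p (s2%:C *: rdir R e)) in e12.
rewrite tt in st1 rt1 st2 rt2.
have [_ [_ h1]] := ht _ _ st1 rt1.
have [_ [h2 _]] := ht _ _ rt2 st2.
rewrite /E /= e12 in h1; rewrite /E /= in h2.
exact: close _ _ _ _ h2 h1.
Qed.

Lemma is_derive_fin_sum (R : realType) (I : finType) (h : I -> R -> R) (dh : I -> R)
    (x : R) :
  (forall i, is_derive x 1 (h i) (dh i)) ->
  is_derive x 1 (fun t => \sum_i h i t) (\sum_i dh i).
Proof.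
move=> dhP; elim: (index_enum I) => [|i s IHs].
  rewrite big_nil (_ : (fun t => _) = cst 0); first exact: is_derive_cst.
  by apply/funext => t; rewrite big_nil.
rewrite big_cons (_ : (fun t => _) = h i + (fun t => \sum_(j <- s) h j t)).
  exact: is_deriveD.
by apply/funext => t; rewrite big_cons.
Qed.

(** Along each segment from p this is [taylor_unit]. The second derivative there
    is a quadratic form in the direction w whose coefficients are uniformly
    close to those at p, and each real coordinate of w is at most [enorm w]. *)
Lemma taylor_upper (R : realType) n (U : set 'rV[R[i]]_n) (f : 'rV[R[i]]_n -> R) p
    (eps : R) :
  open U -> C2_on U f -> U p -> 0 < eps ->
  exists2 r : R, 0 < r & forall w, enorm w <= r -> U (p + w) /\
    f (p + w) <= f p + \sum_d rcoord w d * rderive (rdir R d) f p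
      + (\sum_d \sum_e rcoord w d * rcoord w e * rhess f p d e) / 2
      + eps * enorm w ^+ 2.
Proof.
move=> oU [C1f C2f] Up eps0.
pose N : R := #|{: bool * 'I_n}|%:R.
have sumc (x : R) : \sum_(d : bool * 'I_n) x = N * x.
  by rewrite sumr_const mulr_natl.
have N0 : 0 <= N by rewrite ler0n.
(* [dlt] is a bound for each of N ^ 2 errors; the 1 covers the case n = 0. *)
pose dlt := 2 * eps / (N * N + 1).
have NN : 0 < N * N + 1 by rewrite ltr_wpDl// mulr_ge0.
have dlt0 : 0 < dlt by rewrite divr_gt0// mulr_gt0.
have dltle : N * N * dlt <= 2 * eps.
  rewrite mulrA ler_pdivrMr// mulrC ler_pM2l ?mulr_gt0//; lra.
pose E (x : (bool * 'I_n) * (bool * 'I_n)) : set 'rV[R[i]]_n :=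
  [set w | `|rhess f p x.1 x.2 - rhess f w x.1 x.2| <= dlt].
have nearE : nbhs p [set w | forall x, E x w].
  apply: (@filter_forall _ _ E (nbhs p) _) => -[d e] /=.
  have [_ /(_ d p Up)[_ c]] := C2f e.
  by move/cvgrPdist_le : c; apply.
have nbhs1 : nbhs p (U `&` [set w | forall x, E x w]).
  by apply: filterI => //; exact: open_nbhs_nbhs.
have [r r0 hr] := near_enorm nbhs1.
exists r => // w wr; split; first by have [] := hr w wr.
have inU (t : R) : 0 <= t <= 1 -> enorm (t%:C *: w) <= r.
  move=> /andP[t0 t1]; rewrite enormZ ger0_norm//.
  by apply: le_trans wr; rewrite ler_piMl ?enorm_ge0.
have := @taylor_unit R (fun t => f (p + t%:C *: w))
  (fun t => \sum_e rcoord w e * rderive (rdir R e) f (p + t%:C *: w))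
  (fun t => \sum_e rcoord w e * \sum_d rcoord w d * rhess f (p + t%:C *: w) d e)
  (\sum_d \sum_e rcoord w d * rcoord w e * rhess f p d e + 2 * eps * enorm w ^+ 2).
rewrite !(scale0r w) (scale1r w) !addr0 => taylor.
apply: le_trans (taylor _ _ _) _ => [t t01|t t01|t t01|].
- by apply: is_derive_line_C1 (C1f) _ => //; have [] := hr _ (inU t t01).
- apply: is_derive_fin_sum => e; apply: is_deriveZ.
  by apply: (is_derive_line_C1 oU (C2f e)); have [] := hr _ (inU t t01).
- have [_ Et] := hr _ (inU t t01).
  under eq_bigr do rewrite mulr_sumr.
  rewrite exchange_big -lerBlDl -sumrB.
  apply: (@le_trans _ _ (\sum_(d : bool * 'I_n) \sum_(e : bool * 'I_n)
      dlt * enorm w ^+ 2)).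
    apply: ler_sum => d _; rewrite -sumrB; apply: ler_sum => e _.
    rewrite mulrA (mulrC (rcoord w e)) -mulrBr (le_trans (ler_norm _))// !normrM.
    rewrite distrC mulrC ler_pM ?mulr_ge0//; first exact: (Et (d, e)).
    by rewrite expr2 ler_pM// rcoord_le.
  rewrite sumc sumc (mulrA N) mulrA.
  by apply: ler_wpM2r; [exact: sqr_ge0|exact: dltle].
- rewrite mulrDl !addrA lerD2l; lra.
Qed.

(** * Eigenframes of Hermitian matrices *)

Local Open Scope sesquilinear_scope.

Lemma char_poly_conj (F : fieldType) n (P A : 'M[F]_n) :
  P \in unitmx -> char_poly (invmx P *m A *m P) = char_poly A.
Proof.
move=> Pu; rewrite /char_poly /char_poly_mx.
have PV : map_mx polyC (invmx P) *m map_mx polyC P = 1%:M.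
  by rewrite -map_mxM mulVmx// map_scalar_mx.
have -> : 'X%:M - map_mx polyC (invmx P *m A *m P) =
    map_mx polyC (invmx P) *m ('X%:M - map_mx polyC A) *m map_mx polyC P.
  by rewrite mulmxBr mulmxBl !map_mxM scalar_mxC -(mulmxA 'X%:M) PV mulmx1.
by rewrite !det_mulmx mulrAC -det_mulmx PV det1 mul1r.
Qed.

(** Similar matrices have the same characteristic polynomial, whose roots are
    unique up to order, so counting may be done on any diagonalization. *)
Lemma neg_eigenvalues_conj_diag (R : realType) n (P : 'M[R[i]]_n) (D : 'rV[R[i]]_n) :
  P \in unitmx ->
  neg_eigenvalues (invmx P *m diag_mx D *m P) = #|[pred i | D 0 i < 0]|.
Proof.
move=> Pu; rewrite /neg_eigenvalues; case: closed_field_poly_normal => s /=.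
rewrite char_poly_conj// (monicP (char_poly_monic _)) scale1r.
rewrite char_poly_trig ?diag_mx_is_trig// => e.
have sP : perm_eq s [seq D 0 i | i : 'I_n].
  apply: prod_XsubC_eq; rewrite -e big_map big_enum /=.
  by apply: eq_bigr => i _; rewrite mxE eqxx.
rewrite (permP sP) count_map -sum1_count big_enum_cond -sum1_card.
by apply: eq_bigl => i; rewrite !inE.
Qed.

(** The spectral theorem gives a unitary matrix whose rows are eigenvectors; the
    rows of B are those belonging to m of the negative eigenvalues. *)
Lemma negative_eigenframe (R : realType) n m (A : 'M[R[i]]_n) :
  A \is hermsymmx -> (m <= neg_eigenvalues A)%N ->
  exists (B : 'M[R[i]]_(m, n)) (D : 'I_m -> R),
    [/\ B \is unitarymx, forall j, D j < 0 &
        B *m A = diag_mx (\row_j (D j)%:C) *m B].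
Proof.
move=> Ah; have /orthomx_spectralP := hermitian_normalmx Ah.
set P := spectralmx A; set sp := spectral_diag A => AE.
have Pu : P \in unitmx by exact: spectral_unit.
rewrite {1}AE neg_eigenvalues_conj_diag// => mle.
pose f (j : 'I_m) : 'I_n := enum_val (widen_ord mle j).
have f_inj : injective f.
  by move=> j k /enum_val_inj/(congr1 val)/= /val_inj.
have fneg j : sp 0 (f j) < 0 by have := enum_valP (widen_ord mle j); rewrite inE.
have spE j : sp 0 (f j) = (complex.Re (sp 0 (f j)))%:C.
  by have := fneg j; rewrite ltcE /= => /andP[/eqP + _]; case: (sp 0 _) => a b /= <-.
exists (rowsub f P), (fun j => complex.Re (sp 0 (f j))); split.
- apply/unitarymxP; have /unitarymxP PP := spectral_unitarymx A.
  apply/matrixP => j k; have := congr1 (fun M : 'M[R[i]]_n => M (f j) (f k)) PP.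
  rewrite !mxE (inj_eq f_inj) => <-.
  by apply: eq_bigr => l _; rewrite !mxE.
- by move=> j; have := fneg j; rewrite {1}spE ltcR.
- have PA : P *m A = diag_mx sp *m P.
    by rewrite {1}AE (mulmxA P) (mulmxA P) (mulmxV Pu) mul1mx.
  apply/row_matrixP => j; rewrite row_mul row_rowsub -row_mul PA.
  rewrite !mul_diag_mx; apply/rowP => k; rewrite !mxE.
  by rewrite {1}spE.
Qed.

(** * The complex Hessian as a Levi form *)

Lemma half_complex (R : realType) : 2^-1 = (2^-1)%:C :> R[i].
Proof. by rewrite fmorphV rmorph_nat. Qed.

Lemma half_addi (R : realType) (a b c d : R) :
  2^-1 * ((a +i* b) + 'i * (c +i* d)) = (2^-1 * (a - d)) +i* (2^-1 * (b + c)).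
Proof.
by rewrite half_complex; apply/eqP; rewrite eq_complex /=; apply/andP; split; apply/eqP; ring.
Qed.

Lemma half_subi (R : realType) (a b c d : R) :
  2^-1 * ((a +i* b) - 'i * (c +i* d)) = (2^-1 * (a + d)) +i* (2^-1 * (b - c)).
Proof.
by rewrite half_complex; apply/eqP; rewrite eq_complex /=; apply/andP; split; apply/eqP; ring.
Qed.

Lemma dzbar_real (R : realType) n (f : 'rV[R[i]]_n -> R) l :
  dzbar l (fun w => (f w)%:C) = fun w =>
    (2^-1 * rderive (rdir R (true, l)) f w) +i* (2^-1 * rderive (rdir R (false, l)) f w).
Proof.
apply/funext => w; rewrite /dzbar /cderive /=.
have d0 v : rderive v (fun _ : 'rV[R[i]]_n => 0) w = 0 by exact: derive1_cst.
by rewrite !d0 half_addi subr0 add0r.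
Qed.

(** The four real second derivatives enter with the sign pattern of
    (d/dx - i d/dy)(d/dx + i d/dy) / 4. *)
Lemma complex_hessianE (R : realType) n (U : set 'rV[R[i]]_n) (f : 'rV[R[i]]_n -> R) p k l :
  C2_on U f -> U p -> complex_hessian f p k l =
  (4^-1 * (rhess f p (true, k) (true, l) + rhess f p (false, k) (false, l))) +i*
  (4^-1 * (rhess f p (true, k) (false, l) - rhess f p (false, k) (true, l))).
Proof.
move=> [_ C2f] Up; rewrite mxE dzbar_real /dz /cderive.
have dZ v e : rderivable v (rderive (rdir R e) f) p ->
    rderive v (fun w => 2^-1 * rderive (rdir R e) f w) p =
    2^-1 * rderive v (rderive (rdir R e) f) p.
  move=> /is_derive_line0 h; rewrite /rderive derive1E.
  by have h' := is_deriveZ (2^-1 : R) h; rewrite derive_val.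
have dr d e : rderivable (rdir R d) (rderive (rdir R e) f) p.
  by have [_ /(_ d p Up)[]] := C2f e.
have quarter (a b c d x y z t : R) :
    a = 2^-1 * x -> b = 2^-1 * y -> c = 2^-1 * z -> d = 2^-1 * t ->
    2^-1 * ((a +i* b) - 'i * (c +i* d)) = (4^-1 * (x + t)) +i* (4^-1 * (y - z)).
  by move=> -> -> -> ->; rewrite half_subi; congr (_ +i* _); lra.
exact: (quarter _ _ _ _ _ _ _ _
  (dZ _ _ (dr (true, k) (true, l))) (dZ _ _ (dr (true, k) (false, l)))
  (dZ _ _ (dr (false, k) (true, l))) (dZ _ _ (dr (false, k) (false, l)))).
Qed.

(** Conjugate symmetry of the entries is the symmetry of the real second derivatives,
    the reason why f has to be of class C^2. *)
Lemma complex_hessian_hermitian (R : realType) n (U : set 'rV[R[i]]_n)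
    (f : 'rV[R[i]]_n -> R) p :
  open U -> C2_on U f -> U p -> complex_hessian f p \is hermsymmx.
Proof.
move=> oU C2f Up; apply/is_hermitianmxP; rewrite expr0 scale1r.
apply/matrixP => k l; rewrite [RHS]mxE [in RHS]mxE !(complex_hessianE _ _ C2f Up).
rewrite (rhess_sym (true, l) (true, k) oU C2f Up).
rewrite (rhess_sym (false, l) (false, k) oU C2f Up).
rewrite (rhess_sym (true, l) (false, k) oU C2f Up).
rewrite (rhess_sym (false, l) (true, k) oU C2f Up).
by rewrite -[RHS]/(_ +i* - _) -mulrN opprB.
Qed.

Lemma rcoord_i (R : realType) n (w : 'rV[R[i]]_n) d :
  rcoord ('i *: w) d = if d.1 then - rcoord w (false, d.2) else rcoord w (true, d.2).
Proof.
rewrite /rcoord !mxE /=; case: (w 0 d.2) => a b /=.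
by case: d.1; rewrite !mul0r !mul1r ?sub0r ?add0r.
Qed.

(** This matches a double sum over real directions with the entries of an n by n
    complex matrix. *)
Lemma big_rdir2 (V : nmodType) n (F : bool * 'I_n -> bool * 'I_n -> V) :
  \sum_d \sum_e F d e = \sum_k \sum_l
    ((F (true, k) (true, l) + F (true, k) (false, l)) +
     (F (false, k) (true, l) + F (false, k) (false, l))).
Proof.
rewrite big_rdir; apply: eq_bigr => k _.
by rewrite (big_rdir (F _)) (big_rdir (F _)) -big_split.
Qed.

(** Averaging the real Hessian form over w and i w kills its complex bilinear part
    and leaves twice the Levi form: this is what makes the eigenvalues of the complex
    Hessian visible in the real Taylor expansion. *)
Lemma levi_form (R : realType) n (U : set 'rV[R[i]]_n) (f : 'rV[R[i]]_n -> R) p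
    (w : 'rV[R[i]]_n) : C2_on U f -> U p ->
  \sum_d \sum_e (rcoord w d * rcoord w e + rcoord ('i *: w) d * rcoord ('i *: w) e) *
     rhess f p d e =
  4 * complex.Re ((w *m complex_hessian f p *m w^t*) 0 0).
Proof.
move=> C2f Up; rewrite mxE big_rdir2.
under [in RHS]eq_bigr do rewrite [X in X * _]mxE mulr_suml.
rewrite exchange_big.
have -> (F : 'I_n -> 'I_n -> R[i]) : complex.Re (\sum_k \sum_l F k l) =
    \sum_k \sum_l complex.Re (F k l).
  by rewrite raddf_sum; apply: eq_bigr => k _; rewrite raddf_sum.
rewrite mulr_sumr; apply: eq_bigr => k _.
rewrite mulr_sumr; apply: eq_bigr => l _.
rewrite (complex_hessianE _ _ C2f Up) !mxE !rcoord_i /rcoord /=.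
case: (w 0 k) (w 0 l) => [a b] [c d] /=.
move: (rhess f p _ _) (rhess f p _ _) (rhess f p _ _) (rhess f p _ _) => x y z t.
lra.
Qed.

Lemma enorm_dotmx (R : realType) n (w : 'rV[R[i]]_n) :
  enorm w ^+ 2 = complex.Re ((w *m w^t*) 0 0).
Proof.
rewrite enorm_sum big_rdir mxE raddf_sum; apply: eq_bigr => k _.
by rewrite !mxE /rcoord /=; case: (w 0 k) => a b /=; ring.
Qed.

(** Balls of the slice are mapped isometrically into C^n. *)
Lemma enorm_unitary (R : realType) m n (B : 'M[R[i]]_(m, n)) (z : 'rV[R[i]]_m) :
  B \is unitarymx -> enorm (z *m B) = enorm z.
Proof.
move=> Bu; apply/eqP; rewrite -(eqrXn2 (n := 2)) ?enorm_ge0// !enorm_dotmx.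
by rewrite trmx_mul map_mxM mulmxA mulmxtVK.
Qed.

Lemma diagonal_frame_form (R : realType) m n (A : 'M[R[i]]_n) (B : 'M[R[i]]_(m, n))
    (D : 'I_m -> R) (z : 'rV[R[i]]_m) :
  B \is unitarymx -> B *m A = diag_mx (\row_j (D j)%:C) *m B ->
  complex.Re ((z *m B *m A *m (z *m B)^t*) 0 0) =
    \sum_j D j * (complex.Re (z 0 j) ^+ 2 + complex.Im (z 0 j) ^+ 2).
Proof.
move=> Bu BA; rewrite -(mulmxA z) BA trmx_mul map_mxM 2!mulmxA mulmxtVK//.
rewrite mxE raddf_sum; apply: eq_bigr => j _.
rewrite mul_mx_diag !mxE; case: (z 0 j) => a b /=; ring.
Qed.

Lemma negative_gap (R : realType) m (D : 'I_m -> R) : (forall j, D j < 0) ->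
  exists2 lam : R, 0 < lam & forall j, D j <= - lam.
Proof.
move=> D0; exists (\big[Order.min/1]_j (- D j)).
  apply/bigmin_gtP; split => // j _; by rewrite oppr_gt0.
by move=> j; rewrite lerNr; apply: bigmin_le_cond.
Qed.

Lemma negative_definite_frame (R : realType) n m (A : 'M[R[i]]_n) :
  A \is hermsymmx -> (m <= neg_eigenvalues A)%N ->
  exists (B : 'M[R[i]]_(m, n)) (lam : R), [/\ B \is unitarymx, 0 < lam &
    forall z, complex.Re ((z *m B *m A *m (z *m B)^t*) 0 0) <= - lam * enorm z ^+ 2].
Proof.
move=> Ah /(negative_eigenframe Ah)[B [D [Bu D0 BA]]].
have [lam lam0 Dlam] := negative_gap D0.
exists B, lam; split => // z.
rewrite (diagonal_frame_form z Bu BA) enorm_sum big_rdir mulr_sumr.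
by apply: ler_sum => j _; rewrite ler_wpM2r// addr_ge0 ?sqr_ge0.
Qed.

(** * Means over circles *)

(** The value m is the mean of f over the circle, certified by an antiderivative F:
    in this form the property is closed under sums, whereas the integral would
    require integrability at each step. *)
Definition circle_mean (R : realType) (f : R -> R) (m : R) : Prop :=
  continuous f /\ exists2 F : R -> R, forall t : R, is_derive t 1 F (f t) &
    F (2 * pi) - F 0 = 2 * pi * m.

Lemma circle_mean_integral (R : realType) (f : R -> R) (m : R) : circle_mean f m ->
  (((2 * pi)^-1)%R%:E *
    \int[@lebesgue_measure R]_(t in `[0%R, (2 * pi)%R]%classic) (f t)%:E)%E = m%:E.
Proof.
move=> [cf [F dF Fm]]; have p0 : 0 < 2 * pi :> R by rewrite mulr_gt0// pi_gt0.
have dFc t : {for t, continuous F}.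
  apply: differentiable_continuous; apply/derivable1_diffP.
  exact: (@ex_derive _ _ _ _ _ _ (f t)).
rewrite (@continuous_FTC2 R f F 0 (2 * pi))//.
- by rewrite -EFinB -EFinM Fm mulKf// gt_eqF.
- exact: continuous_subspaceT.
- split.
  + by move=> t _; apply: (@ex_derive _ _ _ _ _ _ (f t)).
  + by apply: cvg_at_right_filter; exact: dFc.
  + by apply: cvg_at_left_filter; exact: dFc.
- by move=> t _; rewrite derive1E; have ? := dF t; rewrite derive_val.
Qed.

(** On a circle a pluriharmonic quadratic function is a combination of 1, cos t,
    sin t, cos 2t and sin 2t, the last two being written with squares and products. *)
Lemma circle_mean_trig (R : realType) (a b c d e : R) :
  circle_mean (fun t => a + b * cos t + c * sin t + d * (cos t ^+ 2 - sin t ^+ 2)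
    + e * (cos t * sin t)) a.
Proof.
split.
  move=> t; apply: differentiable_continuous; apply/derivable1_diffP.
  exact: ex_derive.
exists (fun t => a * t + b * sin t - c * cos t + d * (sin t * cos t) + e / 2 * sin t ^+ 2).
  by move=> t; apply: is_derive_eq; rewrite /GRing.scale/=; lra.
by rewrite mulr_natl cos2pi sin2pi cos0 sin0; ring.
Qed.

Lemma circle_mean_sum (R : realType) (I : finType) (f : I -> R -> R) (m : I -> R) :
  (forall i, circle_mean (f i) (m i)) ->
  circle_mean (fun t => \sum_i f i t) (\sum_i m i).
Proof.
move=> fm; elim: (index_enum I) => [|i s [cs [F dF Fm]]].
  rewrite big_nil (_ : (fun t => _) = cst 0).
    split; first exact: cst_continuous.
    exists (cst 0) => [t|]; first exact: is_derive_cst.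
    by rewrite subrr mulr0.
  by apply/funext => t; rewrite big_nil.
rewrite big_cons (_ : (fun t => _) = f i + (fun t => \sum_(j <- s) f j t)).
  have [ci [G dG Gm]] := fm i; split.
    by move=> t; apply: continuousD; [exact: ci|exact: cs].
  exists (G + F) => [t|]; first exact: is_deriveD.
  rewrite !fctE; lra.
by apply/funext => t; rewrite big_cons.
Qed.

Lemma circle_meanD (R : realType) (f g : R -> R) (a b : R) :
  circle_mean f a -> circle_mean g b -> circle_mean (fun t => f t + g t) (a + b).
Proof.
move=> [cf [F dF Fa]] [cg [G dG Gb]]; split.
  by move=> t; apply: continuousD; [exact: cf|exact: cg].
exists (F + G) => [t|]; first exact: is_deriveD.
rewrite !fctE; lra.
Qed.

(** * Pluriharmonic quadratic functions *)

Lemma rcoordD (R : realType) n (v w : 'rV[R[i]]_n) d :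
  rcoord (v + w) d = rcoord v d + rcoord w d.
Proof.
by rewrite /rcoord !mxE; case: (v 0 d.2) (w 0 d.2) => [a b] [x y] /=; case: ifP.
Qed.

Lemma rcoord0 (R : realType) n d : rcoord (0 : 'rV[R[i]]_n) d = 0.
Proof. by rewrite /rcoord !mxE; case: ifP. Qed.

Lemma rcoord_mulmx (R : realType) m n (B : 'M[R[i]]_(m, n)) (z : 'rV[R[i]]_m) d :
  rcoord (z *m B) d = \sum_e rcoord z e * rcoord (rdir R e *m B) d.
Proof.
rewrite {1}[z]rcoord_sum mulmx_suml.
rewrite (big_morph (fun w => rcoord w d) (fun v w => rcoordD v w d) (rcoord0 R d)).
by apply: eq_bigr => e _; rewrite -scalemxAl rcoordZ.
Qed.

Lemma rcoord_continuous (R : realType) n d :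
  continuous (fun z : 'rV[R[i]]_n => rcoord z d).
Proof.
move=> z; apply: (iffRL (@cvgrPdist_lt _ _ _ (nbhs z) (nbhs_filter z) _ _)) => e e0.
have ec0 : 0 < e%:C :> R[i] by rewrite ltcR.
apply: (@filterS _ (nbhs z) (nbhs_filter z) _ _ _ (nbhsx_ballx z _ ec0)) => w.
move=> [_ /(_ 0 d.2)].
rewrite /ball /= normcRe ltcR; apply: le_lt_trans.
rewrite -sqrtr_sqr ler_wsqrtr// /rcoord.
case: (z 0 d.2) (w 0 d.2) => [a b] [x y] /=.
by case: d.1; rewrite ?lerDl ?lerDr sqr_ge0.
Qed.

Lemma continuous_fin_sum (R : realType) (T : topologicalType) (I : finType)
    (f : I -> T -> R) :
  (forall i, continuous (f i)) -> continuous (fun x => \sum_i f i x).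
Proof.
move=> fc; elim: (index_enum I) => [|i s IHs].
  rewrite (_ : (fun x => _) = cst 0); first exact: cst_continuous.
  by apply/funext => t; rewrite big_nil.
rewrite (_ : (fun x => _) = f i + (fun x => \sum_(j <- s) f j x)).
  by move=> x; apply: continuousD; [exact: fc|exact: IHs].
by apply/funext => t; rewrite big_cons.
Qed.

(** For a real bilinear form S, the function S(w, w) - S(i w, i w) changes sign under
    w |-> i w, hence is the real part of a complex quadratic form. These functions are
    therefore the real parts of the holomorphic polynomials of degree at most two
    that vanish at 0. *)
Definition pluriharm_quad (R : realType) n (l : bool * 'I_n -> R)
    (S : bool * 'I_n -> bool * 'I_n -> R) (w : 'rV[R[i]]_n) : R :=
  \sum_d l d * rcoord w d + \sum_d \sum_e S d e *
    (rcoord w d * rcoord w e - rcoord ('i *: w) d * rcoord ('i *: w) e).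

Lemma rcoord_circle (R : realType) n (a b : 'rV[R[i]]_n) (c s : R) d :
  rcoord (a + (c +i* s) *: b) d =
    rcoord a d + c * rcoord b d + s * rcoord ('i *: b) d.
Proof.
rewrite rcoord_i /rcoord !mxE /=.
by case: (a 0 d.2) (b 0 d.2) => [x y] [z t] /=; case: d.1; ring.
Qed.

Lemma rcoord_circle_i (R : realType) n (a b : 'rV[R[i]]_n) (c s : R) d :
  rcoord ('i *: (a + (c +i* s) *: b)) d =
    rcoord ('i *: a) d + c * rcoord ('i *: b) d - s * rcoord b d.
Proof.
rewrite !rcoord_i /rcoord !mxE /=.
by case: (a 0 d.2) (b 0 d.2) => [x y] [z t] /=; case: d.1; ring.
Qed.

(** Multiplying b by cos t + i sin t rotates the pair (b, i b). In the difference of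
    S at w and at i w the terms in cos^2 and sin^2 appear with opposite
    coefficients, so that only cos 2t survives and the mean is the value at a. *)
Lemma pluriharm_quad_circle (R : realType) n l S (a b : 'rV[R[i]]_n) :
  circle_mean (fun t => pluriharm_quad l S (a + (cos t +i* sin t) *: b))
    (pluriharm_quad l S a).
Proof.
apply: circle_meanD; apply: circle_mean_sum => d.
  have := circle_mean_trig (l d * rcoord a d) (l d * rcoord b d)
    (l d * rcoord ('i *: b) d) 0 0.
  congr circle_mean; apply/funext => t; rewrite rcoord_circle; ring.
apply: circle_mean_sum => e.
have := circle_mean_trig
  (S d e * (rcoord a d * rcoord a e - rcoord ('i *: a) d * rcoord ('i *: a) e))
  (S d e * (rcoord a d * rcoord b e + rcoord b d * rcoord a e
    - rcoord ('i *: a) d * rcoord ('i *: b) e - rcoord ('i *: b) d * rcoord ('i *: a) e))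
  (S d e * (rcoord a d * rcoord ('i *: b) e + rcoord ('i *: b) d * rcoord a e
    + rcoord ('i *: a) d * rcoord b e + rcoord b d * rcoord ('i *: a) e))
  (S d e * (rcoord b d * rcoord b e - rcoord ('i *: b) d * rcoord ('i *: b) e))
  (2 * S d e * (rcoord b d * rcoord ('i *: b) e + rcoord ('i *: b) d * rcoord b e)).
congr circle_mean; apply/funext => t; rewrite !rcoord_circle_i !rcoord_circle.
move: (rcoord _ _) (rcoord _ _) (rcoord _ _) (rcoord _ _) (rcoord _ _) (rcoord _ _)
  (rcoord _ _) (rcoord _ _) (S d e) (cos t) (sin t) => x1 x2 x3 x4 x5 x6 x7 x8 y c s.
ring.
Qed.

Lemma pluriharm_quad_continuous (R : realType) m n l S (B : 'M[R[i]]_(m, n)) :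
  continuous (fun z : 'rV[R[i]]_m => pluriharm_quad l S (z *m B)).
Proof.
have cB d : continuous (fun z : 'rV[R[i]]_m => rcoord (z *m B) d).
  under eq_fun do rewrite rcoord_mulmx.
  apply: continuous_fin_sum => e z; apply: continuousM; last exact: cst_continuous.
  exact: rcoord_continuous.
have ciB d : continuous (fun z : 'rV[R[i]]_m => rcoord ('i *: (z *m B)) d).
  under eq_fun do rewrite scalemxAr rcoord_mulmx.
  apply: continuous_fin_sum => e z; apply: continuousM; last exact: cst_continuous.
  exact: rcoord_continuous.
move=> z; apply: continuousD.
  move: z; apply: continuous_fin_sum => d z; apply: continuousM; first exact: cst_continuous.
  exact: cB.
move: z; apply: continuous_fin_sum => d; apply: continuous_fin_sum => e z.
have cBB : {for z, continuous (fun w : 'rV[R[i]]_m =>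
    rcoord (w *m B) d * rcoord (w *m B) e)}.
  by apply: continuousM; exact: cB.
have ciBiB : {for z, continuous (fun w : 'rV[R[i]]_m =>
    rcoord ('i *: (w *m B)) d * rcoord ('i *: (w *m B)) e)}.
  by apply: continuousM; exact: ciB.
exact: (continuousM (@cst_continuous _ _ (S d e) z) (continuousB cBB ciBiB)).
Qed.

Lemma circle_mean_psh (R : realType) m (h : 'rV[R[i]]_m -> R) :
  continuous h ->
  (forall a b, circle_mean (fun t => h (a + (cos t +i* sin t) *: b)) (h a)) ->
  plurisubharmonic setT (EFin \o h).
Proof.
move=> ch hm; split.
  move=> z _; split; first exact: ltry.
  move=> a za; have /cvgr_lt/(_ a za) := ch z.
  by apply: filterS => w wa _; exact: wa.
by move=> a b _; rewrite [leRHS](circle_mean_integral (hm a b)).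
Qed.

Lemma pluriharm_quad_psh (R : realType) m n l S (B : 'M[R[i]]_(m, n)) :
  plurisubharmonic setT (EFin \o (fun z => pluriharm_quad l S (z *m B))).
Proof.
apply: circle_mean_psh => [|a b]; first exact: pluriharm_quad_continuous.
have e (c : R[i]) : (a + c *: b) *m B = a *m B + c *: (b *m B).
  by rewrite mulmxDl scalemxAl.
under eq_fun do rewrite e.
exact: pluriharm_quad_circle.
Qed.

(** * Touching from above at a point with too many negative eigenvalues *)

(** On the slice spanned by eigenvectors with negative eigenvalues, the second
    order expansion of f at p is the sum of f p, of a pluriharmonic polynomial -h
    and of the Levi form, which is at most - 2 lam |z|^2 for a suitable lam > 0. The Taylor
    error lam |z|^2 consumes half of this, so f + h falls strictly below f p
    on small spheres. *)
Lemma pluriharmonic_majorant_on_slice (R : realType) n m (U : set 'rV[R[i]]_n)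
    (f : 'rV[R[i]]_n -> R) p :
  open U -> C2_on U f -> U p -> (m <= neg_eigenvalues (complex_hessian f p))%N ->
  exists (B : 'M[R[i]]_(m, n)) (h : 'rV[R[i]]_m -> R) (r lam : R),
    [/\ B \is unitarymx, continuous h, plurisubharmonic setT (EFin \o h),
        0 < r /\ 0 < lam & h 0 = 0 /\ forall z, enorm z <= r ->
          U (p + z *m B) /\ f (p + z *m B) + h z <= f p - lam * enorm z ^+ 2].
Proof.
move=> oU C2f Up mneg.
have [B [lam [Bu lam0 levi_neg]]] :=
  negative_definite_frame (complex_hessian_hermitian oU C2f Up) mneg.
have lam2 : 0 < lam / 2 by rewrite divr_gt0.
have [r r0 taylor] := taylor_upper oU C2f Up lam2.
pose h (z : 'rV[R[i]]_m) := pluriharm_quad (fun d => - rderive (rdir R d) f p)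
  (fun d e => - (4^-1 * rhess f p d e)) (z *m B).
exists B, h, r, (lam / 2); split => //.
- exact: pluriharm_quad_continuous.
- exact: pluriharm_quad_psh.
split => [|z zr].
  rewrite /h mul0mx /pluriharm_quad scaler0 !big1 ?addr0// => d _; last first.
    by rewrite rcoord0 mulr0.
  by rewrite big1// => e _; rewrite !rcoord0 mulr0 subr0 mulr0.
have := taylor (z *m B); rewrite (enorm_unitary z Bu) => /(_ zr)[UzB fle].
split; first exact: UzB.
have := levi_form (z *m B) C2f Up; have := levi_neg z.
move: fle; rewrite /h /pluriharm_quad; set w := z *m B.
set q := complex.Re _; set E := enorm z ^+ 2.
set S1 := \sum_d \sum_e (_ + _) * _ ; set S2 := \sum_d \sum_e rcoord w d * rcoord w e * _.
set S3 := \sum_d \sum_e - _ * _.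
have -> : \sum_d - rderive (rdir R d) f p * rcoord w d =
    - \sum_d rcoord w d * rderive (rdir R d) f p.
  by rewrite -sumrN; apply: eq_bigr => d _; rewrite mulNr mulrC.
have S123 : S2 / 2 + S3 = S1 / 4.
  rewrite /S1 /S2 /S3 !mulr_suml -big_split; apply: eq_bigr => d _.
  rewrite !mulr_suml -big_split; apply: eq_bigr => e _ /=.
  lra.
move: (\sum_d _) (f _) (f p) => L fw fp; lra.
Qed.

Lemma neg_eigenvalues_le (R : realType) n (A : 'M[R[i]]_n) :
  (neg_eigenvalues A <= n)%N.
Proof.
rewrite /neg_eigenvalues; case: closed_field_poly_normal => s /= sE.
apply: leq_trans (count_size _ _) _; have := congr1 (fun p : {poly _} => size p) sE.
by rewrite (monicP (char_poly_monic _)) scale1r size_char_poly size_prod_XsubC => -[->].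
Qed.

Theorem proposition2p7 (R : realType) (n q : nat) (U : set 'rV[R[i]]_n)
    (openU : open U) (U_neq0 : U !=set0) (u : 'rV[R[i]]_n -> \bar R)
    (PSHu : PSHq q U u) :
  viscosity_PSHq q U u.
Proof.
case: PSHu => uscu PSHu; split; first exact: uscu.
have [uoo|/existsNP[z0 /not_implyP[Uz0 uz0]]] := pselect (forall z, U z -> u z = -oo%E).
  by left.
right=> phi C2phi p Up pmax; rewrite leqNgt; apply/negP => negq.
have [B [h [r [lam [Bu ch hpsh [r0 lam0] [h0 hB]]]]]] :=
  pluriharmonic_majorant_on_slice openU C2phi Up negq.
(* If u p were -oo, maximality at p would make u identically -oo. *)
have upfin : u p \is a fin_num.
  have upoo := (uscu p Up).1; rewrite fin_numE; apply/andP; split; last first.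
    by rewrite lt_eqF.
  apply/eqP => up; apply: uz0; have := pmax z0 Uz0; rewrite up /=.
  by case: (u z0).
have qn : (q < n)%N := leq_trans negq (neg_eigenvalues_le _).
(* The slice passes through p, where u is finite, so that the maximum principle
   on balls is the case that applies; it is used on the ball of radius r. *)
have [_] := PSHu qn p B Bu.
case=> [/(_ 0)|].
  by rewrite /= mul0mx addr0 => /(_ Up) up; rewrite up in upfin.
move=> /(_ 0 r setT h r0)[||||//|w].
- by move=> z; rewrite /cball /= subr0 => /hB[].
- exact: openT.
- by [].
- by move=> z _; exact: ch.
rewrite /sphere /= subr0 => wr /(_ 0).
rewrite /cball /= subrr mul0mx addr0 h0 adde0 => umax.
have e0 : enorm (0 : 'rV[R[i]]_q.+1) <= r.
  by have := enormZ w 0; rewrite scale0r normr0 mul0r => ->; exact: ltW.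
have wle : enorm w <= r by rewrite wr.
have [Uw phiw] := hB w wle.
have drop : 0 < lam * enorm w ^+ 2 by rewrite wr mulr_gt0// exprn_gt0.
move: (umax e0) (pmax _ Uw); rewrite -(fineK upfin).
case: (u (p + w *m B)) => [b| |] //=; rewrite ?lee_fin.
lra.
Qed.
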